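(* Let $X$ be a normed linear space over $K$ (where $K=\mathbb{R}$ or $K=\mathbb{C}$) and let $x\in S_X$. The following are equivalent: 1. $x$ is an exposed point of $B_X$. 2. There exists a Hamel basis of $X$ containing $x$ which is strongly orthonormal relative to $x$ in the sense of Birkhoff-James. 3. There exists a bounded linear operator $A$ on $X$ which attains its norm only at the points of the form $\lambda x$ with $\lambda\in S_K$.
   Context: $S_X=\{x\in X:\|x\|=1\}$ is the unit sphere and $B_X=\{x\in X:\|x\|\le 1\}$ is the unit ball of $X$; $S_K=\{\lambda\in K:|\lambda|=1\}$. A point $x$ in the boundary of a convex set $S$ is an exposed point of $S$ iff there exists a hyperplane of support $H$ to $S$ through $x$ such that $H\cap S=\{x\}$. For $S=B_X$ and $x\in S_X$, a hyperplane of support to $B_X$ through $x$ is a set $H=\{y\in X: f(y)=1\}$, where $f:X\to K$ is a continuous linear functional with $\|f\|=1$ and $f(x)=1$. A finite set $S=\{x_1,\dots,x_n\}\subset X$ (of distinct elements) is strongly orthogonal relative to an element $x_{i_0}\in S$ in the sense of Birkhoff-James iff $\|x_{i_0}\| < \|x_{i_0}+\sum_{j\neq i_0}\lambda_j x_j\|$ for all scalars $\lambda_j\in K$ ($1\le j\le n$, $j\ne i_0$) that are not all $0$. An infinite set is strongly orthogonal relative to an element contained in it iff every finite subset containing that element is strongly orthogonal relative to that element. The set is called strongly orthonormal relative to the element if, in addition, every element of the set has norm $1$. A bounded linear operator $A:X\to X$ attains its norm only at the points of the form $\lambda x$ with $\lambda\in S_K$ if $\{y\in S_X:\|Ay\|=\|A\|\}=\{\lambda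 x:\lambda\in S_K\}$ (in particular the norm is attained), where $\|A\|$ is the operator norm. *)

(* Defs.v *)
From HB Require Import structures.
From mathcomp Require Import all_boot all_order all_algebra.
From mathcomp Require Import finmap.
From mathcomp Require Import all_classical all_reals all_analysis.
From mathcomp Require Import complex.
Set Implicit Arguments.
Unset Strict Implicit.
Unset Printing Implicit Defensive.
Import Order.TTheory GRing.Theory Num.Theory.
Import numFieldNormedType.Exports.
Local Open Scope classical_set_scope.
Local Open Scope ring_scope.

Definition unit_sphere (K : numFieldType) (X : normedModType K) : set X :=
  [set y | `|y| = 1].

Definition unit_ball (K : numFieldType) (X : normedModType K) : set X :=
  [set y | `|y| <= 1].

Arguments unit_sphere {K} X _.
Arguments unit_ball {K} X _.

Definition bounded_operator (K : numFieldType) (X Y : normedModType K)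
    (A : X -> Y) : Prop :=
  exists M : K, forall y, `|A y| <= M * `|y|.

(* Norms take their values in [K] itself; over the complex numbers the order
   is partial ([a <= b] iff [b - a] is a nonnegative real), and the least upper
   bound of a bounded nonempty set of nonnegative reals is the usual one. *)
Definition operator_norm (K : numFieldType) (X Y : normedModType K)
    (A : X -> Y) : K :=
  supremum 0 [set `|A y| | y in unit_ball X].

Definition support_hyperplane_unit_ball (K : numFieldType)
    (X : normedModType K) (x : X) (H : set X) : Prop :=
  exists f : {linear X -> K^o},
    [/\ continuous f, operator_norm f = 1, f x = 1 & H = [set y | f y = 1]].

Definition exposed_point_unit_ball (K : numFieldType) (X : normedModType K)
    (x : X) : Prop :=
  exists H : set X,
    support_hyperplane_unit_ball x H /\ H `&` unit_ball X = [set x].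

Definition linearly_independent (K : numFieldType) (X : lmodType K)
    (B : set X) : Prop :=
  forall (S : {fset X}) (c : X -> K), [set` S] `<=` B ->
    \sum_(y <- S) c y *: y = 0 -> forall y, y \in S -> c y = 0.

Definition spanning (K : numFieldType) (X : lmodType K) (B : set X) : Prop :=
  forall v : X, exists (S : {fset X}) (c : X -> K),
    [set` S] `<=` B /\ v = \sum_(y <- S) c y *: y.

Definition hamel_basis (K : numFieldType) (X : lmodType K) (B : set X) : Prop :=
  linearly_independent B /\ spanning B.

Definition fset_strongly_orthogonal (K : numFieldType) (X : normedModType K)
    (S : {fset X}) (x : X) : Prop :=
  x \in S /\
  forall c : X -> K, (exists y, [/\ y \in S, y != x & c y != 0]) ->
    `|x| < `|x + \sum_(y <- S | y != x) c y *: y|.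

Definition strongly_orthogonal (K : numFieldType) (X : normedModType K)
    (B : set X) (x : X) : Prop :=
  [/\ B x,
      finite_set B -> fset_strongly_orthogonal (fset_set B) x
    & infinite_set B -> forall S : {fset X},
        [set` S] `<=` B -> x \in S -> fset_strongly_orthogonal S x].

Definition strongly_orthonormal (K : numFieldType) (X : normedModType K)
    (B : set X) (x : X) : Prop :=
  strongly_orthogonal B x /\ B `<=` unit_sphere X.

Definition attains_norm_only_at (K : numFieldType) (X : normedModType K)
    (A : X -> X) (x : X) : Prop :=
  [set y | unit_sphere X y /\ `|A y| = operator_norm A]
    = [set l *: x | l in [set l : K | `|l| = 1]].

(* Main.v *)
(* If [f] exposes [x], then [x] together with a Hamel basis of unit vectors of
   [ker f] is strongly orthonormal relative to [x], because
   [1 = f (x + w) <= |x + w|] for [w] in [ker f].  Conversely such a basis yields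
   [A v = f v *: x], where [f v] is the coefficient of [x] in [v]: strong
   orthogonality says that [|f v| < |v|] unless [v] is a multiple of [x] or
   [f v = 0].  Finally, if [A] attains its norm only at the multiples of [x] and
   [g] is a norming functional of [A x], then [g \o A], divided by the norm of
   [A], exposes [x]. *)
Require Import Defs.
From HB Require Import structures.
From mathcomp Require Import all_boot all_order all_algebra.
From mathcomp Require Import finmap.
From mathcomp Require Import all_classical all_reals all_analysis.
From mathcomp Require Import complex ring lra.
Set Implicit Arguments.
Unset Strict Implicit.
Unset Printing Implicit Defensive.
Import Order.TTheory GRing.Theory Num.Theory.
Import numFieldNormedType.Exports.
Local Open Scope classical_set_scope.
Local Open Scope ring_scope.

(** * The Hahn-Banach theorem for sublinear functionals *)

(* Real scalars act on the [K]-module [X] through [e], so that a single statement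
   covers real spaces and the real structure underlying a complex space.  The
   functional is found as a minimal sublinear one, which avoids any extension of
   partially defined functionals. *)
Section HahnBanach.
Variables (R : realType) (K : numFieldType) (e : {rmorphism R -> K}).
Variable X : lmodType K.
Implicit Types (p q : X -> R) (x y z : X).

(** Homogeneity is asked only as an inequality for positive scalars, which is quicker to check for
    infima; applying it to [s^-1] recovers the equality. *)
Definition sublinear q : Prop :=
  (forall x y, q (x + y) <= q x + q y) /\
  (forall s x, 0 < s -> q (e s *: x) <= s * q x).

Lemma sublinear0 q : sublinear q -> q 0 = 0.
Proof.
move=> [_ qZ].
have := qZ 2 0 (ltr0n _ 2); have := qZ 2^-1 0.
rewrite !scaler0 invr_gt0 ltr0n => /(_ isT) h1 h2.
lra.
Qed.

Lemma sublinearZ q s x : sublinear q -> 0 <= s -> q (e s *: x) = s * q x.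
Proof.
move=> qs; rewrite le_eqVlt => /predU1P[<-|s0].
  by rewrite rmorph0 scale0r mul0r sublinear0.
have [_ qZ] := qs; apply/eqP; rewrite eq_le qZ//=.
have := qZ s^-1 (e s *: x); rewrite invr_gt0 => /(_ s0).
rewrite scalerA -rmorphM mulVf ?gt_eqF// rmorph1 scale1r.
by rewrite ler_pdivlMl.
Qed.

Lemma sublinear_opp q x : sublinear q -> - q (- x) <= q x.
Proof.
move=> qs; have [qD _] := qs.
by have := qD x (- x); rewrite subrr sublinear0//; lra.
Qed.

(** The pointwise infimum works: it is finite because every member is bounded below by [- p (- x)].
    The empty chain is served by [p] itself. *)
Lemma sublinear_chain_inf p (F : set (X -> R)) : sublinear p ->
  (forall q, F q -> sublinear q /\ forall x, q x <= p x) ->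
  (forall q1 q2, F q1 -> F q2 ->
     (forall x, q1 x <= q2 x) \/ (forall x, q2 x <= q1 x)) ->
  exists2 q, sublinear q /\ (forall x, q x <= p x) &
    forall q1, F q1 -> forall x, q x <= q1 x.
Proof.
move=> ps Fp Ftot; have [[q0 Fq0]|F0] := pselect (F !=set0); last first.
  by exists p => // q Fq; exfalso; apply: F0; exists q.
pose E x := [set q x | q in F].
have Elb x : lbound (E x) (- p (- x)).
  move=> _ [q Fq <-]; have [qs qp] := Fp _ Fq.
  by apply: le_trans (sublinear_opp x qs); rewrite lerN2.
have Ei x : has_inf (E x) by split; [exists (q0 x); exists q0|eexists; exact: Elb].
have Ele q x : F q -> inf (E x) <= q x.
  by move=> Fq; apply: ge_inf; [exact: (Ei x).2|exists q].
exists (fun x => inf (E x)); last by move=> q Fq x; exact: Ele.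
split; last by move=> x; apply: le_trans (Ele _ _ Fq0) ((Fp _ Fq0).2 x).
split=> [x y|s x s0].
  rewrite /= -lerBlDr; apply: lb_le_inf; first exact: (Ei x).1.
  move=> _ [q1 Fq1 <-]; rewrite lerBlDr -lerBlDl.
  apply: lb_le_inf; first exact: (Ei y).1.
  move=> _ [q2 Fq2 <-]; rewrite lerBlDl.
  (* The smaller of the two functionals is used at both [x] and [y], so that its own subadditivity
     applies. *)
  have [q12|q21] := Ftot _ _ Fq1 Fq2.
    apply: le_trans (Ele q1 _ Fq1) _; apply: le_trans ((Fp _ Fq1).1.1 x y) _.
    by rewrite lerD2l.
  apply: le_trans (Ele q2 _ Fq2) _; apply: le_trans ((Fp _ Fq2).1.1 x y) _.
  by rewrite lerD2r.
rewrite /= -ler_pdivrMl//; apply: lb_le_inf; first exact: (Ei x).1.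
move=> _ [q Fq <-]; rewrite ler_pdivrMl//.
exact: le_trans (Ele q _ Fq) ((Fp _ Fq).1.2 _ _ s0).
Qed.

(* The largest sublinear minorant of [q] taking the value [- q z] at [- z]. *)
Lemma sublinear_lower q z : sublinear q ->
  exists2 q', sublinear q' & (forall x, q' x <= q x) /\ q' (- z) <= - q z.
Proof.
move=> qs; have [qD qZ] := qs.
(* The minorant is the infimum of [E x]: [t = 0] bounds it by [q x], and [t = 1] at [- z] bounds it
   by [- q z]. *)
pose E x := [set q (x + e t *: z) - t * q z | t in [set t | 0 <= t]].
have Elb x : lbound (E x) (- q (- x)).
  move=> _ [t t0 <-]; rewrite -(sublinearZ z qs t0).
  by have := qD (x + e t *: z) (- x); rewrite addrAC subrr add0r; lra.
have Ei x : has_inf (E x).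
  by split; [exists (q (x + e 0 *: z) - 0 * q z); exists 0 => /=
            |eexists; exact: Elb].
have Ele t x : 0 <= t -> inf (E x) <= q (x + e t *: z) - t * q z.
  by move=> t0; apply: ge_inf; [exact: (Ei x).2|exists t].
exists (fun x => inf (E x)); last first.
  split=> [x|].
    by have := Ele 0 x (lexx _); rewrite rmorph0 scale0r addr0 mul0r subr0.
  have := Ele 1 (- z) ler01; rewrite rmorph1 scale1r addNr mul1r.
  by rewrite sublinear0// sub0r.
split=> [x y|s x s0].
  rewrite /= -lerBlDr; apply: lb_le_inf; first exact: (Ei x).1.
  move=> _ [t t0 <-]; rewrite lerBlDr -lerBlDl.
  apply: lb_le_inf; first exact: (Ei y).1.
  move=> _ [u u0 <-]; rewrite lerBlDl.
  apply: le_trans (Ele (t + u) _ (addr_ge0 t0 u0)) _.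
  have := qD (x + e t *: z) (y + e u *: z).
  by rewrite rmorphD scalerDl addrACA; lra.
rewrite /= -ler_pdivrMl//; apply: lb_le_inf; first exact: (Ei x).1.
move=> _ [t t0 <-]; rewrite ler_pdivrMl//.
apply: le_trans (Ele (s * t) _ (mulr_ge0 (ltW s0) t0)) _.
rewrite rmorphM -scalerA -scalerDr mulrBr mulrA lerD2r.
exact: qZ.
Qed.

(** Zorn's lemma for the reversed pointwise order, with [sublinear_chain_inf] bounding the
    chains. *)
Lemma minimal_sublinear p : sublinear p ->
  exists2 f, sublinear f /\ (forall x, f x <= p x) &
    forall q, sublinear q -> (forall x, q x <= f x) -> q = f.
Proof.
move=> ps; pose T := {q | sublinear q /\ forall x, q x <= p x}.
pose leT (q1 q2 : T) := `[< forall x, sval q2 x <= sval q1 x >].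
have [|||F Ftot|f fmin] := @Zorn T leT.
- by move=> t; apply/asboolP.
- move=> r s t /asboolP rs /asboolP st; apply/asboolP => x.
  exact: le_trans (st x) (rs x).
- move=> [s Ps] [t Pt] /asboolP/= st /asboolP/= ts; apply: eq_exist.
  by apply/funext => x; apply/eqP; rewrite eq_le st ts.
- have [|q1 q2 [t1 Ft1 <-] [t2 Ft2 <-]|q qs qF] :=
    @sublinear_chain_inf p [set sval t | t in F] ps.
  + by move=> _ [[q qs] _ <-].
  + by have [/asboolP|/asboolP] := Ftot _ _ Ft1 Ft2; [right|left].
  by exists (exist _ q qs) => s Fs; apply/asboolP; apply: qF; exists s.
exists (sval f); first exact: (svalP f).
move=> q qs qf; have qp x : q x <= p x := le_trans (qf x) ((svalP f).2 x).
have /fmin/(congr1 sval) : leT f (exist _ q (conj qs qp)) by apply/asboolP.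
by [].
Qed.

(** First [p] is lowered to a [p'] with [p' (- z) <= - p z], then a minimal [f] below [p'] is taken.
    Lowering [f] at any [x] cannot change it, so [f] is odd; an odd subadditive map is additive.
    Oddness turns the bound at [- z] into [p z <= f z]. *)
Theorem hahn_banach p z : sublinear p ->
  exists f : X -> R, [/\ forall x y, f (x + y) = f x + f y,
    forall s x, f (e s *: x) = s * f x, forall x, f x <= p x & f z = p z].
Proof.
move=> ps; have [p' p's [p'p p'z]] := sublinear_lower z ps.
have [f [fs fp'] fmin] := minimal_sublinear p's.
have fN x : f (- x) = - f x.
  have [q qs [qf qx]] := sublinear_lower x fs.
  have /fmin := qf => /(_ qs) qE; rewrite qE in qx.
  apply/eqP; rewrite eq_le qx /=.
  by have := sublinear_opp x fs; lra.
exists f; split.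
- move=> x y; apply/eqP; rewrite eq_le fs.1 /=.
  by have := fs.1 (- x) (- y); rewrite -opprD !fN; lra.
- move=> s x; have [s0|/ltW s0] := leP 0 s; first exact: sublinearZ.
  rewrite -[s]opprK rmorphN scaleNr fN sublinearZ ?mulNr//.
  by rewrite oppr_ge0.
- by move=> x; apply: le_trans (fp' x) (p'p x).
- apply/eqP; rewrite eq_le (le_trans (fp' z) (p'p z))/=.
  by have := le_trans (fp' (- z)) p'z; rewrite fN lerN2.
Qed.

End HahnBanach.

(** * Norming functionals and suprema over the reals *)

Lemma linear_exists (K : numFieldType) (X Y : lmodType K) (f : X -> Y) :
  linear f -> exists h : {linear X -> Y}, h =1 f.
Proof.
move=> lf.
pose h : {linear X -> Y} := HB.pack f (GRing.isLinear.Build _ _ _ _ f lf).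
by exists h.
Qed.

(** This property and the next one isolate what the equivalence takes from the real or complex
    field; everything else is proved over any [numFieldType]. *)
Definition has_norming_functionals (K : numFieldType) (X : normedModType K) :=
  forall z : X, exists h : {linear X -> K^o},
    (forall y, `|h y| <= `|y|) /\ h z = `|z|.

Definition has_bounded_suprema (K : numFieldType) := forall E : set K,
  E !=set0 -> (forall a, E a -> 0 <= a) -> ubound E !=set0 ->
  supremums E !=set0.

Lemma has_norming_functionals_real (R : realType) (X : normedModType R) :
  has_norming_functionals X.
Proof.
move=> z; have [|f [fD fZ fle fz]] :=
    @hahn_banach R R idfun X (fun x : X => `|x|) z.
  by split=> [x y|s x s0]; rewrite ?ler_normD// normrZ gtr0_norm.
have [|h hf] := @linear_exists R X R^o f.
  by move=> a x y; rewrite fD fZ.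
exists h; split => [y|]; rewrite hf// ler_norml fle andbT lerNl.
have := fZ (-1) y; rewrite /= scaleN1r mulN1r => <-.
by rewrite -(normrN y).
Qed.

Lemma has_bounded_suprema_real (R : realType) : has_bounded_suprema R.
Proof.
move=> E E0 _ Eu; exists (sup E); split.
  by apply: sup_upper_bound; split.
by move=> b Eb; apply: ge_sup.
Qed.

(** * Norming functionals and suprema over the complex numbers *)

Section Complex.
Variable R : realType.
Local Open Scope complex_scope.

Lemma ger0_complexE (a : R[i]) : 0 <= a -> a = (complex.Re a)%:C.
Proof. by case: a => u v; rewrite lecE /= => /andP[/eqP-> _]. Qed.

Lemma has_bounded_suprema_complex : has_bounded_suprema R[i].
Proof.
move=> E [a Ea] Epos [b Eb].
have supE : has_sup [set complex.Re c | c in E].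
  split; first by exists (complex.Re a), a.
  exists (complex.Re b) => _ [c Ec <-].
  by have := Eb _ Ec; rewrite lecE => /andP[].
exists (sup [set complex.Re c | c in E])%:C; split => [c Ec|d Ed].
  rewrite (ger0_complexE (Epos _ Ec)) lecR.
  by apply: sup_upper_bound => //; exists c.
(* An upper bound [d] of the real number [a] has the same imaginary part as [a], so it is real and
   only real parts remain to be compared. *)
have := Ed _ Ea; rewrite lecE => /andP[/eqP dE _].
rewrite lecE dE (ger0_complexE (Epos _ Ea)) /= eqxx /=.
apply: ge_sup; first exact: supE.1.
by move=> _ [c Ec <-]; have := Ed _ Ec; rewrite lecE => /andP[].
Qed.

(* A real-linear [f] is the real part of the complex-linear
   [y |-> f y - i f (i y)]. *)
Lemma has_norming_functionals_complex (X : normedModType R[i]) :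
  has_norming_functionals X.
Proof.
move=> z; have [|f [fD fZ fle fz]] :=
    @hahn_banach R R[i] (real_complex R) X (fun x : X => complex.Re `|x|) z.
  split=> [x y|s x s0].
    by have := ler_normD x y; rewrite lecE => /andP[_]; rewrite raddfD.
  rewrite normrZ ger0_norm; last by rewrite ler0c ltW.
  by rewrite (ger0_complexE (normr_ge0 x)) -rmorphM.
pose hf y := (f y -i* f ('i *: y) : R[i]^o)%C.
have [|h hE] := @linear_exists R[i] X R[i]^o hf.
  move=> [s t] x y; rewrite /hf.
  have -> : (s +i* t)%C *: x = s%:C *: x + t%:C *: ('i *: x).
    by rewrite scalerA -scalerDl; congr (_ *: _); simpc.
  rewrite !fD !fZ !scalerDr !fD.
  have -> : 'i *: (s%:C *: x) = s%:C *: ('i *: x).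
    by rewrite !scalerA mulrC.
  have -> : 'i *: (t%:C *: ('i *: x)) = (-t)%:C *: x.
    by rewrite !scalerA; congr (_ *: _); simpc.
  rewrite !fZ; apply/eqP; rewrite eq_complex /=.
  by apply/andP; split; apply/eqP; ring.
have hle y : `|h y| <= `|y|.
  have [->|hy0] := eqVneq (h y) 0; first by rewrite normr0.
  (* Rotating [y] by the unimodular [u] makes the value of [h] real and nonnegative, hence equal to
     its real part [f (u *: y)], which [fle] bounds. *)
  pose u := `|h y| / h y.
  have u1 : `|u| = 1 by rewrite normrM normrV ?unitfE// normr_id divff ?normr_eq0.
  have huy : h (u *: y) = `|h y| by rewrite linearZ; exact: divfK.
  have -> : `|y| = `|u *: y| by rewrite normrZ u1 mul1r.
  rewrite -huy (ger0_complexE (normr_ge0 (u *: y))).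
  rewrite huy (ger0_complexE (normr_ge0 (h y))) -huy hE lecR /=.
  exact: fle.
exists h; split => //.
(* The real part of [h z] is already [|z|], so [|h z| <= |z|] leaves no room for an imaginary
   part. *)
have : `|h z| ^+ 2 <= `|z| ^+ 2 by rewrite ler_sqr ?nnegrE.
rewrite -add_Re2_Im2 (ger0_complexE (normr_ge0 z)) -rmorphXn lecR hE /= fz.
rewrite sqrrN gerDl => fiz; have /eqP : f ('i *: z) ^+ 2 = 0.
  by apply/eqP; rewrite eq_le fiz sqr_ge0.
by rewrite sqrf_eq0 /hf fz => /eqP ->; rewrite oppr0.
Qed.
End Complex.

(** * Suprema and the operator norm *)

Lemma supremumP d (T : porderType d) (x0 : T) (E : set T) : E !=set0 ->
  supremums E !=set0 -> supremums E (supremum x0 E).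
Proof.
by move=> /set0P E0; rewrite /supremum (negbTE E0) => -[m Em]; exact: (xgetI x0 Em).
Qed.

Section OperatorNorm.
Variables (K : numFieldType) (X Y : normedModType K).
Implicit Type A : {linear X -> Y}.

(** An upper bound that is attained is the least one, and least upper bounds are unique. *)
Lemma operator_norm_max A z m : unit_ball X z -> `|A z| = m ->
  (forall y, unit_ball X y -> `|A y| <= m) -> operator_norm A = m.
Proof.
move=> z1 Az Am; pose E := [set `|A y| | y in unit_ball X].
have Em : supremums E m.
  split=> [_ [y y1 <-]|b]; first exact: Am.
  by apply; exists z.
apply: (is_subset1_supremums _ Em).
by apply: supremumP; [exists m, z|exists m].
Qed.

Lemma operator_norm_le A :
  supremums [set `|A y| | y in unit_ball X] !=set0 ->
  forall y, `|A y| <= operator_norm A * `|y|.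
Proof.
move=> A0 y; have [->|y0] := eqVneq y 0.
  by rewrite linear0 !normr0 mulr0.
have ny0 : 0 < `|y| by rewrite normr_gt0.
rewrite -ler_pdivrMr// mulrC -[X in X * _]ger0_norm ?invr_ge0//.
rewrite -normrZ -linearZ.
have E_y : [set `|A y| | y in unit_ball X] `|A (`|y|^-1 *: y)|.
  exists (`|y|^-1 *: y) => //=.
  by rewrite /unit_ball /= normrZ ger0_norm ?invr_ge0// mulVf ?gt_eqF.
by apply: (supremumP 0 _ A0).1; first by eexists; exact: E_y.
Qed.

(** Without a least upper bound, [supremum 0] returns its default [0]; a nonzero value is therefore
    a genuine supremum. *)
Lemma operator_norm_neq0_has_supremum A : operator_norm A != 0 ->
  supremums [set `|A y| | y in unit_ball X] !=set0.
Proof.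
move=> A0; apply: contrapT => S0; move/eqP: A0; apply.
rewrite /operator_norm /supremum; case: ifP => // _.
by case: xgetP => // a _ Sa; exfalso; apply: S0; exists a.
Qed.

Lemma bounded_operator_has_supremum A : has_bounded_suprema K ->
  bounded_operator A -> supremums [set `|A y| | y in unit_ball X] !=set0.
Proof.
move=> supK [M AM]; apply: supK.
- by exists `|A 0|, 0 => //; rewrite /unit_ball /= normr0 ler01.
- by move=> _ [y _ <-].
(* The constant [M] is seen to be nonnegative by evaluating the bound at a nonzero vector; in the
   trivial space all values are [0]. *)
- have [[x x0]|Xtriv] := pselect (exists x : X, x != 0).
    have M0 : 0 <= M.
      have nx0 : 0 < `|x| by rewrite normr_gt0.
      by rewrite -(pmulr_lge0 _ nx0); apply: le_trans (AM x).
    exists M => _ [y y1 <-]; apply: le_trans (AM y) _.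
    exact: ler_piMr.
  exists 0 => _ [y _ <-]; have [->|y0] := eqVneq y 0.
    by rewrite linear0 normr0.
  by exfalso; apply: Xtriv; exists y.
Qed.

End OperatorNorm.

(** * Spans and maximal free subsets *)

Section Span.
Variables (K : numFieldType) (X : lmodType K).
Implicit Types (B C D : set X) (S T : {fset X}) (c : X -> K).

Definition in_span B (v : X) := exists S c,
  [set` S] `<=` B /\ v = \sum_(y <- S) c y *: y.

(** Padding with zero coefficients brings two combinations to a common support, so that they can be
    added. *)
Lemma sum_extend S T c : (S `<=` T)%fset ->
  \sum_(y <- S) c y *: y = \sum_(y <- T) (if y \in S then c y else 0) *: y.
Proof.
move=> ST; rewrite -(big_fset_incl _ ST).
  rewrite big_seq [RHS]big_seq.
  by apply: eq_bigr => y ->.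
by move=> y _ /negbTE ->; rewrite scale0r.
Qed.

Lemma in_span0 B : in_span B 0.
Proof. by exists fset0, (fun=> 0); split=> //; rewrite big_seq_fset0. Qed.

Lemma in_spanS B C v : B `<=` C -> in_span B v -> in_span C v.
Proof. by move=> BC [S [c [SB ->]]]; exists S, c; split=> // y /SB/BC. Qed.

Lemma in_span_mem B v : B v -> in_span B v.
Proof.
move=> Bv; exists [fset v]%fset, (fun=> 1); split.
  by move=> y /=; rewrite inE => /eqP ->.
by rewrite big_seq_fset1 scale1r.
Qed.

Lemma in_spanZ B a v : in_span B v -> in_span B (a *: v).
Proof.
move=> [S [c [SB ->]]]; exists S, (fun y => a * c y); split=> //.
by rewrite scaler_sumr; apply: eq_bigr => y _; rewrite scalerA.
Qed.

Lemma in_spanD B v w : in_span B v -> in_span B w -> in_span B (v + w).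
Proof.
move=> [S [c [SB ->]]] [T [d [TB ->]]].
exists (S `|` T)%fset, (fun y => (if y \in S then c y else 0) +
  (if y \in T then d y else 0)); split.
  by move=> y /=; rewrite inE => /orP[/SB|/TB].
rewrite (sum_extend c (fsubsetUl S T)) (sum_extend d (fsubsetUr S T)).
by rewrite -big_split; apply: eq_bigr => y _; rewrite scalerDl.
Qed.

Lemma in_spanN B v : in_span B v -> in_span B (- v).
Proof. by rewrite -scaleN1r; exact: in_spanZ. Qed.

Lemma in_spanB B v w : in_span B v -> in_span B w -> in_span B (v - w).
Proof. by move=> Bv /in_spanN; exact: in_spanD. Qed.

Lemma in_span_setD1 B x v : in_span B v ->
  exists a w, in_span (B `\ x) w /\ v = a *: x + w.
Proof.
move=> [S [c [SB ->]]]; have [xS|xS] := boolP (x \in S).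
  exists (c x), (\sum_(y <- (S `\ x)%fset) c y *: y); split.
    exists (S `\ x)%fset, c; split=> // y /=.
    by rewrite !inE => /andP[/eqP yx /SB].
  by rewrite (big_fsetD1 x).
exists 0, (\sum_(y <- S) c y *: y); split; last by rewrite scale0r add0r.
exists S, c; split=> // y /= yS; split; first exact: SB.
by move=> /= yx; move: xS; rewrite -yx yS.
Qed.

(** By induction on [S]: a member containing [S] without [y] and a member containing [y] are
    comparable. This gives freeness of the union of a chain of free sets. *)
Lemma fset_sub_chain (F : set (set X)) S : F !=set0 ->
  total_on F subset -> [set` S] `<=` \bigcup_(B in F) B ->
  exists2 B, F B & [set` S] `<=` B.
Proof.
move=> [B0 FB0] Ftot; elim/finSet_rect: S => S IH SF.
have [->|/fset0Pn[y yS]] := eqVneq S fset0; first by exists B0.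
have [|z zS|B FB SB] := IH (S `\ y)%fset.
- exact: fproperD1.
- by apply: SF; move: zS; rewrite /= !inE => /andP[].
have [B' FB' B'y] := SF y yS.
have [C FC [BC B'C]] : exists2 C, F C & B `<=` C /\ B' `<=` C.
  by have [?|?] := Ftot _ _ FB FB'; [exists B'|exists B] => //; split.
exists C => // z zS; have [->|zy] := eqVneq z y; first exact: B'C.
by apply/BC/SB; rewrite /= !inE zy.
Qed.

(** A relation with a nonzero coefficient at [v] could be solved for [v], placing it in the span of
    [B]. *)
Lemma linearly_independentU1 B v : linearly_independent B ->
  ~ in_span B v -> linearly_independent (v |` B).
Proof.
move=> Bfree Bv S c SB S0.
have SvB : [set` (S `\ v)%fset] `<=` B.
  by move=> y; rewrite /= !inE => /andP[/eqP yv /SB[/yv|]].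
have [vS|vS] := boolP (v \in S); last first.
  apply: (Bfree S c) => // y yS; have [|//] := SB y yS.
  by move=> yv; move: vS; rewrite -yv yS.
rewrite (big_fsetD1 v)//= in S0.
have cv0 : c v = 0.
  apply: contrapT => /eqP cv; apply: Bv.
  exists (S `\ v)%fset, (fun y => - (c v)^-1 * c y); split=> //.
  transitivity (- (c v)^-1 *: \sum_(y <- (S `\ v)%fset) c y *: y).
    move/eqP: S0; rewrite addrC addr_eq0 => /eqP ->.
    by rewrite scalerN scaleNr opprK scalerA mulVf// scale1r.
  by rewrite scaler_sumr; apply: eq_bigr => y _; rewrite scalerA.
move=> y yS; have [->//|yv] := eqVneq y v.
apply: (Bfree _ c SvB); last by rewrite !inE yv.
by rewrite -[RHS]S0 cv0 scale0r add0r.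
Qed.

(** Zorn's lemma gives a maximal free subset of [D]; a vector of [D] outside its span could still be
    adjoined. *)
Lemma exists_free_subset D : exists B : set X,
  [/\ B `<=` D, linearly_independent B & forall v, D v -> in_span B v].
Proof.
have [|B [[BD Bfree] Bmax]] :=
    @Zorn_bigcup X [set B | B `<=` D /\ linearly_independent B].
  move=> F FP Ftot; split; first by apply: bigcup_sub => B /FP[].
  move=> S c SF; have [F0|F0] := pselect (F !=set0).
    have [B FB SB] := fset_sub_chain F0 Ftot SF.
    exact: (FP _ FB).2.
  (* For the empty chain the union is empty, and so is [S]. *)
  move=> _ y yS; have [B FB _] := SF y yS.
  by exfalso; apply: F0; exists B.
exists B; split=> // v Dv; apply: contrapT => Bv.
apply: (Bmax (v |` B)); last first.
  split; last exact: linearly_independentU1.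
  by move=> y [->|/BD].
split; first by move=> y; right.
by move=> /(_ v (or_introl erefl)) /in_span_mem.
Qed.

End Span.

(** * Strong orthogonality in terms of spans *)

Section StronglyOrthogonal.
Variables (K : numFieldType) (X : normedModType K).
Implicit Types (B : set X) (x : X).

Lemma fset_strongly_orthogonal_sub (S T : {fset X}) x : (S `<=` T)%fset ->
  x \in S -> fset_strongly_orthogonal T x -> fset_strongly_orthogonal S x.
Proof.
move=> ST xS [_ Tx]; split=> // c [y [yS yx cy]].
pose d z := if z \in S then c z else 0.
have -> : \sum_(z <- S | z != x) c z *: z = \sum_(z <- T | z != x) d z *: z.
  rewrite big_mkcond [RHS]big_mkcond /= -(big_fset_incl _ ST).
    rewrite big_seq [RHS]big_seq; apply: eq_bigr => z zS.
    by rewrite /d zS.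
  by move=> z _ /negbTE zS; rewrite /d zS scale0r if_same.
apply: Tx; exists y; split=> //; first exact: (fsubsetP ST).
by rewrite /d yS.
Qed.

(** Orthogonality passes to finite subsets containing [x] by padding coefficients with zeros, which
    merges the finite and infinite cases of the definition. *)
Lemma strongly_orthogonalP B x : strongly_orthogonal B x <->
  B x /\ forall S : {fset X}, [set` S] `<=` B -> x \in S ->
    fset_strongly_orthogonal S x.
Proof.
split=> [[Bx Bfin Binf]|[Bx BS]].
  split=> // S SB xS; have [/[dup] finB /Bfin Borth|] := pselect (finite_set B).
    apply: fset_strongly_orthogonal_sub Borth => //.
    by apply/fsubsetP => y yS; rewrite in_fset_set// inE; exact: SB.
  by move/Binf; apply.
split=> // finB; apply: BS; first by rewrite fset_setK.
by rewrite in_fset_set// inE.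
Qed.

(** Coefficient-free form of the condition: every representation of a nonzero [w] has a nonzero
    coefficient. *)
Lemma strongly_orthogonal_lt B x w : strongly_orthogonal B x ->
  in_span (B `\ x) w -> w != 0 -> `|x| < `|x + w|.
Proof.
move=> /strongly_orthogonalP[Bx BS] [S [c [SB ->]]] w0.
have Sx y : y \in S -> y != x by move=> /SB[_ /eqP].
have [y yS cy] : exists2 y, y \in S & c y != 0.
  apply: contrapT => Sc; move/eqP: w0; apply.
  rewrite big_seq big1// => y yS; have [->|cy] := eqVneq (c y) 0.
    by rewrite scale0r.
  by exfalso; apply: Sc; exists y.
have [||_ lt_x] := BS (x |` S)%fset.
- by move=> z; rewrite /= !inE => /predU1P[->|/SB[]].
- by rewrite !inE eqxx.
have <- : \sum_(z <- (x |` S)%fset | z != x) c z *: z =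
    \sum_(z <- S) c z *: z.
  rewrite big_mkcond big_fsetU1/=; last by apply/negP => /Sx; rewrite eqxx.
  rewrite eqxx add0r big_seq [RHS]big_seq.
  by apply: eq_bigr => z /Sx ->.
apply: lt_x; exists y; split=> //; last exact: Sx.
by rewrite !inE yS orbT.
Qed.

End StronglyOrthogonal.

(** * The three implications *)

Section Equivalences.
Variables (K : numFieldType) (X : normedModType K) (x : X).
Hypothesis x1 : unit_sphere X x.

Let x0 : x != 0.
Proof. by rewrite -normr_eq0 x1 oner_eq0. Qed.

Let sphere_ball y : unit_sphere X y -> unit_ball X y.
Proof. by rewrite /unit_ball /= => ->. Qed.

Lemma exposed_point_hamel_basis : exposed_point_unit_ball x ->
  exists B : set X, [/\ hamel_basis B, B x & strongly_orthonormal B x].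
Proof.
move=> [H [[f [_ f1 fx ->]] fexp]].
have fle y : `|f y| <= `|y|.
  have := @operator_norm_le K X K^o f _ y; rewrite f1 mul1r; apply.
  by apply: operator_norm_neq0_has_supremum; rewrite f1 oner_eq0.
have fexpP y : `|y| <= 1 -> f y = 1 -> y = x.
  by move=> y1 fy; suff : [set x] y by []; rewrite -fexp.
have [C [CD Cfree Cspan]] :=
  exists_free_subset [set y : X | f y = 0 /\ unit_sphere X y].
have Cx : ~ C x by move=> /CD[]; rewrite fx => /eqP; rewrite oner_eq0.
have fC v : in_span C v -> f v = 0.
  move=> [S [c [SC ->]]]; rewrite linear_sum big_seq big1// => y /SC/CD[fy _].
  by rewrite linearZ fy; exact: mulr0.
(* [C] spans only the unit vectors of the kernel by construction; normalising extends this to the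
   whole kernel. *)
have ker_span v : f v = 0 -> in_span C v.
  move=> fv; have [->|v0] := eqVneq v 0; first exact: in_span0.
  have nv0 : `|v| != 0 by rewrite normr_eq0.
  rewrite -[v]scale1r -(divff nv0) -scalerA; apply/in_spanZ/Cspan; split.
    by rewrite linearZ fv; exact: mulr0.
  by rewrite /unit_sphere /= normrZ normrV ?unitfE// normr_id mulVf.
have Bfree : linearly_independent (x |` C).
  apply: linearly_independentU1 => // /fC; rewrite fx => /eqP.
  by rewrite oner_eq0.
exists (x |` C); split; [split=> // v|by left|split].
- rewrite -[v](subrK (f v *: x)) addrC; apply: in_spanD.
    by apply/in_spanZ/in_span_mem; left.
  apply: (@in_spanS _ _ C); first by move=> y; right.
  apply: ker_span; rewrite linearB linearZ fx.
  by apply/eqP; rewrite subr_eq0 eq_sym; apply/eqP; exact: mulr1.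
- apply/strongly_orthogonalP; split; first by left.
  move=> S SB xS; split=> // c [y [yS yx cy]].
  pose w := \sum_(y <- S | y != x) c y *: y.
  have SxC : [set` (S `\ x)%fset] `<=` C.
    by move=> z; rewrite /= !inE => /andP[/eqP zx /SB[/zx|]].
  have wE : w = \sum_(y <- (S `\ x)%fset) c y *: y.
    rewrite /w big_mkcond (big_fsetD1 x)//= eqxx add0r big_seq [RHS]big_seq.
    by apply: eq_bigr => z; rewrite !inE => /andP[->].
  have fxw : f (x + w) = 1.
    by rewrite linearD fx fC ?addr0//; exists (S `\ x)%fset, c.
  have xw_ge1 : 1 <= `|x + w| by have := fle (x + w); rewrite fxw normr1.
  rewrite -/w x1 lt_neqAle xw_ge1 andbT.
  (* If equality held, [x + w] would lie in the ball and on the hyperplane, so [w = 0] by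
     exposedness, against the freeness of [C]. *)
  apply/eqP => xw1; have /eqP : x + w = x by apply: fexpP; rewrite -?xw1.
  rewrite -subr_eq0 addrAC subrr add0r wE => /eqP w0.
  have := Cfree _ c SxC w0 y; rewrite !inE yx yS => /(_ isT) cy0.
  by rewrite cy0 eqxx in cy.
- by move=> y [->//|/CD[]].
Qed.

Lemma hamel_basis_operator :
  (exists B : set X, [/\ hamel_basis B, B x & strongly_orthonormal B x]) ->
  exists A : {linear X -> X}, bounded_operator A /\ attains_norm_only_at A x.
Proof.
move=> [B [[_ Bspan] _ [Borth _]]].
pose W := in_span (B `\ x).
have Wlt w : W w -> w != 0 -> 1 < `|x + w|.
  by move=> Ww w0; rewrite -[1]x1; exact: strongly_orthogonal_lt Ww w0.
have /choice[f fP] v : exists a, W (v - a *: x).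
  have [a [w [Ww ->]]] := in_span_setD1 x (Bspan v).
  by exists a; rewrite addrAC subrr add0r.
(* Two distinct coefficients would put a nonzero multiple of [x], hence [- x], into [W]; then [Wlt]
   would give [1 < |x - x|]. *)
have f_uniq v a : W (v - a *: x) -> f v = a.
  move=> Wa; apply/eqP; rewrite -subr_eq0; apply/negPn/negP => fa0.
  have : W ((f v - a) *: x).
    have -> : (f v - a) *: x = (v - a *: x) - (v - f v *: x).
      by rewrite opprB [RHS]addrC addrA subrK scalerBl.
    exact: (in_spanB Wa (fP v)).
  move=> /(in_spanZ (- (f v - a)^-1)); rewrite scalerA mulNr mulVf// scaleN1r.
  by move=> /Wlt; rewrite oppr_eq0 subrr normr0 ltr10 => /(_ x0).
have flin : linear (fun v => f v *: x).
  move=> a u v; rewrite scalerA -scalerDl; congr (_ *: _).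
  apply: f_uniq; rewrite scalerDl -scalerA opprD addrACA -scalerBr.
  exact: in_spanD (in_spanZ a (fP u)) (fP v).
have [A AE] := linear_exists flin.
have nA v : `|A v| = `|f v| by rewrite AE normrZ x1 mulr1.
have vE v : v = f v *: x + (v - f v *: x) by rewrite addrC subrK.
(* Dividing [v] by [f v] reduces the claim to [Wlt]. *)
have f_lt v : v != f v *: x -> f v != 0 -> `|f v| < `|v|.
  move=> vx fv0; rewrite {2}(vE v).
  have -> : f v *: x + (v - f v *: x) =
      f v *: (x + (f v)^-1 *: (v - f v *: x)).
    by rewrite scalerDr scalerA divff// scale1r.
  rewrite normrZ ltr_pMr ?normr_gt0//; apply: Wlt; first exact: in_spanZ (fP v).
  by rewrite scaler_eq0 invr_eq0 negb_or fv0 subr_eq0.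
have f_le v : `|f v| <= `|v|.
  have [->|fv0] := eqVneq (f v) 0; first by rewrite normr0.
  have [vx|vx] := eqVneq v (f v *: x); last exact/ltW/f_lt.
  by rewrite {2}vx normrZ x1 mulr1.
have fx l : f (l *: x) = l.
  by apply: f_uniq; rewrite subrr; exact: in_span0.
have A1 : operator_norm A = 1.
  apply: (@operator_norm_max _ _ _ A x); first exact: sphere_ball.
    by rewrite nA -[x in f x]scale1r fx normr1.
  by move=> y y1; rewrite nA; exact: le_trans (f_le y) y1.
exists A; split; first by exists 1 => y; rewrite nA mul1r.
apply/seteqP; split=> [y [y1]|_ [l l1 <-]]; rewrite /= A1 nA.
  move=> fy1; exists (f y) => //; apply/eqP; rewrite eq_sym.
  apply: contraPT fy1 => /f_lt; rewrite -normr_eq0 => + fy.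
  by rewrite fy oner_eq0 y1 ltxx => /(_ isT).
by split; [rewrite /unit_sphere /= normrZ x1 mulr1|rewrite fx].
Qed.

Lemma operator_exposed_point :
  has_bounded_suprema K -> has_norming_functionals X ->
  (exists A : {linear X -> X}, bounded_operator A /\ attains_norm_only_at A x) ->
  exposed_point_unit_ball x.
Proof.
move=> supK normX [A0 [A0b A0x]].
(* If [A0 = 0], every unit vector is a multiple of [x], and the identity also
   attains its norm only at multiples of [x]. *)
have [A [N [N0 AN Ax AxP]]] : exists (A : {linear X -> X}) (N : K),
    [/\ 0 < N, forall y, `|A y| <= N * `|y|, `|A x| = N &
      forall y, `|y| = 1 -> `|A y| = N -> exists l, y = l *: x].
  have [N0|N0] := eqVneq (operator_norm A0) 0.
    exists idfun, 1; split=> // [y|y y1 _]; first by rewrite mul1r.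
    have : [set l *: x | l in [set l : K | `|l| = 1]] y.
      rewrite -A0x; split=> //; rewrite N0; apply/eqP.
      rewrite eq_le normr_ge0 andbT -(mul0r `|y|) -N0.
      by apply: operator_norm_le; exact: bounded_operator_has_supremum.
    by case=> l _ <-; exists l.
  have Ax : `|A0 x| = operator_norm A0.
    suff : [set l *: x | l in [set l : K | `|l| = 1]] x by rewrite -A0x => -[].
    by exists 1; rewrite ?scale1r//= normr1.
  exists A0, (operator_norm A0); split=> //.
  - by rewrite lt_neqAle eq_sym N0 -Ax normr_ge0.
  - exact/operator_norm_le/bounded_operator_has_supremum.
  - move=> y y1 Ay; suff : [set l *: x | l in [set l : K | `|l| = 1]] y.
      by case=> l _ <-; exists l.
    by rewrite -A0x.
have [g [gle gAx]] := normX (A x).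
(* The factor [N^-1] makes the functional equal to [1] at [x], since [g (A x) = |A x| = N]. *)
have flin : linear (fun y => N^-1 * g (A y) : K^o).
  move=> a u v; rewrite !linearP mulrDr; congr (_ + _).
  by rewrite [LHS]mulrCA.
have [f fE] := linear_exists flin.
have fA y : `|f y| <= N^-1 * `|A y|.
  by rewrite fE normrM gtr0_norm ?invr_gt0// ler_pM2l ?invr_gt0.
have fle y : `|f y| <= `|y|.
  by apply: le_trans (fA y) _; rewrite ler_pdivrMl.
have fx : f x = 1 by rewrite fE gAx Ax mulVf// gt_eqF.
exists [set y | f y = 1]; split.
  exists f; split=> //.
    apply/linear_bounded_continuous/linear_boundedP.
    by near=> r => y; apply: le_trans (fle y) _; rewrite ler_peMl.
  apply: (@operator_norm_max _ _ _ f x); first exact: sphere_ball.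
    by rewrite fx normr1.
  by move=> y y1; exact: le_trans (fle y) y1.
apply/seteqP; split=> [y [/= fy y1]|_ ->]; last first.
  by split=> //; exact: sphere_ball.
have ny : `|y| = 1.
  by have := fle y; rewrite fy normr1 => ?; apply/eqP; rewrite eq_le y1.
(* From [f y = 1] and [fA] follows [N <= |A y|], so [A] attains its norm at [y] and [y = l *: x];
   then [f x = 1] forces [l = 1]. *)
have [|l yl] := AxP y ny.
  apply/eqP; rewrite eq_le -{1}(mulr1 N) -{1}ny AN /=.
  by have := fA y; rewrite fy normr1 ler_pdivlMl// mulr1.
move: fy; rewrite yl linearZ fx => l1.
by rewrite -[l](mulr1 l : l * 1 = l) [l * 1]l1 scale1r.
Unshelve. all: by end_near. Qed.

End Equivalences.

(** * The equivalence over both scalar fields *)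

Lemma exposed_point_tfae (K : numFieldType) (X : normedModType K) (x : X) :
  has_bounded_suprema K -> has_norming_functionals X -> unit_sphere X x ->
  [<-> exposed_point_unit_ball x;
       exists B : set X, [/\ hamel_basis B, B x & strongly_orthonormal B x];
       exists A : {linear X -> X},
         bounded_operator A /\ attains_norm_only_at A x].
Proof.
move=> supK normX x1; tfae.
- exact: exposed_point_hamel_basis.
- exact: hamel_basis_operator.
- exact: operator_exposed_point.
Qed.

Local Open Scope complex_scope.

Theorem theorem2p6 (R : realType) :
  (forall (X : normedModType R) (x : X), unit_sphere X x ->
     [<-> exposed_point_unit_ball x;
          exists B : set X,
            [/\ hamel_basis B, B x & strongly_orthonormal B x];
          exists A : {linear X -> X},
            bounded_operator A /\ attains_norm_only_at A x])
  /\
  (forall (X : normedModType R[i]) (x : X), unit_sphere X x ->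
     [<-> exposed_point_unit_ball x;
          exists B : set X,
            [/\ hamel_basis B, B x & strongly_orthonormal B x];
          exists A : {linear X -> X},
            bounded_operator A /\ attains_norm_only_at A x]).
Proof.
split=> X x x1; apply: exposed_point_tfae => //.
- exact: has_bounded_suprema_real.
- exact: has_norming_functionals_real.
- exact: has_bounded_suprema_complex.
- exact: has_norming_functionals_complex.
Qed.
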